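(* Let $M,N,d$ be positive integers. For $i=1,\dots,M$, $j=1,\dots,N$ let $x_{ij}\in\mathbb{R}^d$, $y_{ij}\in\{+1,-1\}$, with the points drawn from a continuous (absolutely continuous) distribution and the dataset satisfying: each $C_i=\{w:\ y_{ij}x_{ij}^Tw\ge1,\ j=1,\dots,N\}$ is nonempty and $\bar C=\bigcap_{i=1}^MC_i\neq\emptyset$. Let $\alpha^k=1-\frac{1}{k+1}$. For $\lambda>0$ define Modified Local-GD iterates by $w_0^0=0$ and, for $k\ge0$, $$w_i^{k+1}=\arg\min_{w}\sum_{j=1}^N\exp(-y_{ij}x_{ij}^Tw)+\frac\lambda2\|w-w_0^k\|^2,\qquad w_0^{k+1}=(1-\alpha^k)w_0^0+\alpha^k\Big(\frac1M\sum_{i=1}^Mw_i^{k+1}\Big).$$ Let $\hat w=\arg\min_{w\in\bar C}\|w\|$ (the hard-margin SVM solution on all data, to which the centralized model trained by gradient descent on the total exponential loss from $0$ converges in direction). Then, for almost all such datasets, $$\lim_{K\to\infty}\lim_{\lambda\to0}\frac{w_0^K(\lambda)}{\|w_0^K(\lambda)\|}=\frac{\hat w}{\|\hat w\|}.$$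
   Context: Modified Local-GD differs from Local-GD only in the aggregation step, which mixes the initial point with the average of the local models. Each local problem is solved exactly (unique minimizer) in every round. *)

(* Defs.v *)
From HB Require Import structures.
From mathcomp Require Import all_boot all_order all_algebra.
From mathcomp Require Import all_classical all_reals all_analysis.
Set Implicit Arguments. Unset Strict Implicit. Unset Printing Implicit Defensive.
Import Order.TTheory GRing.Theory Num.Theory.
Import numFieldNormedType.Exports.
Local Open Scope classical_set_scope.
Local Open Scope ring_scope.

Section Defs.
Variable R : realType.

Definition dotp d (u v : 'rV[R]_d) : R := \sum_(k < d) u 0 k * v 0 k.
Definition sqnorm d (u : 'rV[R]_d) : R := dotp u u.
Definition enorm d (u : 'rV[R]_d) : R := Num.sqrt (sqnorm u).
(** u / ||u|| (equal to 0 when u = 0). *)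
Definition normalize d (u : 'rV[R]_d) : 'rV[R]_d := (enorm u)^-1 *: u.

Definition argmin d (f : 'rV[R]_d -> R) : 'rV[R]_d :=
  xget 0 [set w | forall v, f w <= f v].

Variables (M N d : nat).
Variables (x : 'I_M -> 'I_N -> 'rV[R]_d) (y : 'I_M -> 'I_N -> R).

Definition Cset (i : 'I_M) : set 'rV[R]_d :=
  [set w | forall j : 'I_N, 1 <= y i j * dotp (x i j) w].
Definition Cbar : set 'rV[R]_d := [set w | forall i, Cset i w].

Definition svm_sol : 'rV[R]_d :=
  xget 0 [set w | Cbar w /\ forall v, Cbar v -> enorm w <= enorm v].

Definition local_loss (i : 'I_M) (w : 'rV[R]_d) : R :=
  \sum_(j < N) expR (- (y i j * dotp (x i j) w)).
Definition local_obj (lam : R) (i : 'I_M) (w0 w : 'rV[R]_d) : R :=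
  local_loss i w + lam / 2 * sqnorm (w - w0).

Definition alpha (k : nat) : R := 1 - (k.+1%:R)^-1.

Definition local_step (lam : R) (i : 'I_M) (w0k : 'rV[R]_d) : 'rV[R]_d :=
  argmin (local_obj lam i w0k).

Definition w_init : 'rV[R]_d := 0.
Fixpoint w0 (lam : R) (k : nat) : 'rV[R]_d :=
  match k with
  | 0 => w_init
  | k'.+1 => (1 - alpha k') *: w_init +
             alpha k' *: ((M%:R)^-1 *: \sum_(i < M) local_step lam i (w0 lam k'))
  end.

End Defs.

Definition lebesgue_null {R : realType} {I : finType} (A : set (I -> R)) : Prop :=
  forall e : R, 0 < e ->
  exists (a b : nat -> I -> R),
    (forall n i, a n i <= b n i) /\
    (A `<=` \bigcup_n [set z | forall i, a n i <= z i <= b n i]) /\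
    (forall K, \sum_(n < K) \prod_(i : I) (b n i - a n i) <= e).

Definition data_of {R : realType} {M N d : nat}
  (X : 'I_M * 'I_N * 'I_d -> R) : 'I_M -> 'I_N -> 'rV[R]_d :=
  fun i j => \row_(k < d) X (i, j, k).

(* Main.v *)
Require Import Defs.
From HB Require Import structures.
From mathcomp Require Import all_boot all_order all_algebra.
From mathcomp Require Import all_classical all_reals all_analysis.
From mathcomp Require Import ring lra.
Import Order.TTheory GRing.Theory Num.Theory.
Import numFieldNormedType.Exports.
Local Open Scope classical_set_scope.
Local Open Scope ring_scope.
Set Implicit Arguments.
Unset Strict Implicit.

(** Rescale by [L = - ln lam].  As [lam] tends to [0+], an exponential loss term
    becomes the hard constraint [1 <= y x^T w], so each local step becomes the
    Euclidean projection [P_i] onto [C_i], and [w_0^k / L] converges to [v_k], where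
    [v_0 = 0] and [v_(k+1) = alpha_k * (1/M) sum_i P_i v_k].  This is Halpern's
    iteration anchored at [0] for a nonexpansive map whose fixed points are the
    points of [Cbar]; it converges to the projection of [0] onto [Cbar], which is the
    (nonzero) SVM solution.  Normalization is continuous there and invariant under
    the rescaling. *)

(** * Euclidean inner product and norm on row vectors *)

Section InnerProduct.
Context {R : realType} {d : nat}.
Implicit Types (u v w : 'rV[R]_d) (c : R).

Lemma dotpC u v : dotp u v = dotp v u.
Proof. by apply: eq_bigr => k _; rewrite mulrC. Qed.

Lemma dotpDl u v w : dotp (u + v) w = dotp u w + dotp v w.
Proof. by rewrite -big_split; apply: eq_bigr => k _; rewrite mxE mulrDl. Qed.

Lemma dotpZl c u v : dotp (c *: u) v = c * dotp u v.
Proof. by rewrite /dotp mulr_sumr; apply: eq_bigr => k _; rewrite mxE mulrA. Qed.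

Lemma dotpDr u v w : dotp u (v + w) = dotp u v + dotp u w.
Proof. by rewrite dotpC dotpDl !(dotpC u). Qed.

Lemma dotpZr c u v : dotp u (c *: v) = c * dotp u v.
Proof. by rewrite dotpC dotpZl dotpC. Qed.

Lemma dotpNl u v : dotp (- u) v = - dotp u v.
Proof. by rewrite -scaleN1r dotpZl mulN1r. Qed.

Lemma dotpNr u v : dotp u (- v) = - dotp u v.
Proof. by rewrite dotpC dotpNl dotpC. Qed.

Lemma dotp0l u : dotp 0 u = 0.
Proof. by rewrite -(scale0r 0) dotpZl mul0r. Qed.

Lemma dotp0r u : dotp u 0 = 0.
Proof. by rewrite dotpC dotp0l. Qed.

Lemma dotp_suml (I : Type) (r : seq I) (F : I -> 'rV[R]_d) v :
  dotp (\sum_(i <- r) F i) v = \sum_(i <- r) dotp (F i) v.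
Proof.
elim: r => [|i r IH]; first by rewrite !big_nil dotp0l.
by rewrite !big_cons dotpDl IH.
Qed.

Definition dotpE :=
  (dotpDl, dotpDr, dotpNl, dotpNr, dotpZl, dotpZr, dotp0l, dotp0r).

Lemma sqnorm_ge0 u : 0 <= sqnorm u.
Proof. by apply: sumr_ge0 => k _; rewrite -expr2 sqr_ge0. Qed.

Lemma sqnorm_eq0 u : sqnorm u = 0 -> u = 0.
Proof.
move/eqP; rewrite psumr_eq0 => [/allP u0|k _]; last by rewrite -expr2 sqr_ge0.
apply/rowP => k; rewrite mxE; apply/eqP.
by have := u0 k (mem_index_enum k); rewrite /= mulf_eq0 orbb.
Qed.

Lemma sqnormD u v : sqnorm (u + v) = sqnorm u + 2 * dotp u v + sqnorm v.
Proof. by rewrite /sqnorm !dotpE (dotpC v u); ring. Qed.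

Lemma sqnormZ c u : sqnorm (c *: u) = c ^+ 2 * sqnorm u.
Proof. by rewrite /sqnorm !dotpE; ring. Qed.

Lemma sqnormN u : sqnorm (- u) = sqnorm u.
Proof. by rewrite /sqnorm !dotpE; ring. Qed.

Lemma sqnormB u v : sqnorm (u - v) = sqnorm u - 2 * dotp u v + sqnorm v.
Proof. by rewrite sqnormD sqnormN dotpNr; ring. Qed.

Lemma sqnormD_le u v : sqnorm (u + v) <= 2 * sqnorm u + 2 * sqnorm v.
Proof. by have := sqnorm_ge0 (u - v); rewrite sqnormB sqnormD; lra. Qed.

Lemma sqr_coord_le u k : u 0 k ^+ 2 <= sqnorm u.
Proof.
rewrite /sqnorm /dotp (bigD1 k) //= expr2 lerDl.
by apply: sumr_ge0 => j _; rewrite -expr2 sqr_ge0.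
Qed.

(** Cauchy-Schwarz: the vector [sqnorm v *: u - dotp u v *: v] has squared norm [sqnorm v] times the
    difference of the two sides; [v = 0] is treated apart. *)
Lemma dotp_sqr_le u v : dotp u v ^+ 2 <= sqnorm u * sqnorm v.
Proof.
have := sqnorm_ge0 (sqnorm v *: u - dotp u v *: v).
have -> : sqnorm (sqnorm v *: u - dotp u v *: v) =
    sqnorm v * (sqnorm u * sqnorm v - dotp u v ^+ 2).
  by rewrite sqnormB !sqnormZ !dotpE; ring.
have [v0|v0] := eqVneq (sqnorm v) 0.
  by rewrite (sqnorm_eq0 v0) dotp0r /sqnorm dotp0l mulr0 expr0n.
by rewrite pmulr_rge0 ?subr_ge0 // lt_neqAle eq_sym v0 sqnorm_ge0.
Qed.

Lemma enorm_ge0 u : 0 <= enorm u.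
Proof. exact: sqrtr_ge0. Qed.

Lemma sqr_enorm u : enorm u ^+ 2 = sqnorm u.
Proof. by rewrite sqr_sqrtr // sqnorm_ge0. Qed.

Lemma dotp_enorm_le u v : dotp u v <= enorm u * enorm v.
Proof.
rewrite (le_trans (ler_norm _)) // -sqrtrM ?sqnorm_ge0 //.
by rewrite -sqrtr_sqr ler_sqrt ?mulr_ge0 ?sqnorm_ge0 // dotp_sqr_le.
Qed.

Lemma enorm_le u v : (enorm u <= enorm v) = (sqnorm u <= sqnorm v).
Proof. by rewrite /enorm ler_sqrt ?sqnorm_ge0. Qed.

Lemma enormZ c u : 0 <= c -> enorm (c *: u) = c * enorm u.
Proof.
by move=> c0; rewrite /enorm sqnormZ sqrtrM ?sqr_ge0 // sqrtr_sqr ger0_norm.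
Qed.

Lemma enormN u : enorm (- u) = enorm u.
Proof. by rewrite /enorm sqnormN. Qed.

Lemma enormD u v : enorm (u + v) <= enorm u + enorm v.
Proof.
rewrite -(@ler_pXn2r _ 2) ?nnegrE ?addr_ge0 ?enorm_ge0 //.
rewrite sqr_enorm sqnormD sqrrD !sqr_enorm.
by have := dotp_enorm_le u v; lra.
Qed.

Lemma enorm0 : enorm (0 : 'rV[R]_d) = 0.
Proof. by rewrite /enorm /sqnorm dotp0l sqrtr0. Qed.

Lemma enorm_sum (I : Type) (r : seq I) (F : I -> 'rV[R]_d) :
  enorm (\sum_(i <- r) F i) <= \sum_(i <- r) enorm (F i).
Proof.
elim: r => [|i r IH]; first by rewrite !big_nil enorm0.
by rewrite !big_cons (le_trans (enormD _ _)) // lerD2l.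
Qed.

Lemma normalizeZ c u : 0 < c -> normalize (c *: u) = normalize u.
Proof.
move=> c0; rewrite /normalize enormZ ?(ltW c0) // scalerA invfM mulrAC.
by rewrite mulVf ?gt_eqF // mul1r.
Qed.

End InnerProduct.

(** * Euclidean quantities in the sup-norm topology; existence of minimizers *)

Section EuclideanTopology.
Context {R : realType} {d : nat}.
Implicit Types (u v w : 'rV[R]_d).

Lemma cvg_dotp (T : Type) (F : set_system T) {FF : Filter F}
    (f g : T -> 'rV[R]_d) (a b : 'rV[R]_d) :
  f @ F --> a -> g @ F --> b -> dotp (f t) (g t) @[t --> F] --> dotp a b.
Proof.
move=> fa gb; apply: cvg_big => [|k _]; first exact: add_continuous.
by apply: cvgM; [apply: (cvg_comp f (fun u : 'rV[R]_d => u 0 k) fa)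
  | apply: (cvg_comp g (fun u : 'rV[R]_d => u 0 k) gb)]; exact: coord_continuous.
Qed.

Lemma cvg_sqnormB (T : Type) (F : set_system T) {FF : Filter F}
    (f : T -> 'rV[R]_d) (a q : 'rV[R]_d) :
  f @ F --> a -> sqnorm (f t - q) @[t --> F] --> sqnorm (a - q).
Proof.
move=> fa; have fq : f t - q @[t --> F] --> a - q.
  by apply: cvgB => //; exact: cvg_cst.
exact: (cvg_dotp fq fq).
Qed.

Lemma continuous_sqnormB q : continuous (fun u : 'rV[R]_d => sqnorm (u - q)).
Proof. by move=> u; apply: (@cvg_sqnormB _ (nbhs u) _ id u q); exact: cvg_id. Qed.

Lemma continuous_dotp u : continuous (fun v : 'rV[R]_d => dotp u v).
Proof.
move=> v; apply: (@cvg_dotp _ (nbhs v) _ (cst u) id u v); last exact: cvg_id.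
exact: cvg_cst.
Qed.

Lemma cvg_normalize (T : Type) (F : set_system T) {FF : Filter F}
    (f : T -> 'rV[R]_d) (a : 'rV[R]_d) :
  a != 0 -> f @ F --> a -> normalize (f t) @[t --> F] --> normalize a.
Proof.
move=> a0 fa; apply: cvgZ => //; apply: cvgV.
  rewrite gt_eqF // sqrtr_gt0 lt_neqAle sqnorm_ge0 andbT eq_sym.
  by apply: contra a0 => /eqP/sqnorm_eq0 ->.
apply: (cvg_comp (fun t => sqnorm (f t))); last exact: sqrt_continuous.
exact: cvg_dotp.
Qed.

(** Balls of row vectors are coordinatewise, and each squared coordinate is at most [sqnorm]. *)
Lemma cvg_sqnormP (T : Type) (F : set_system T) {FF : Filter F}
    (f : T -> 'rV[R]_d) (a : 'rV[R]_d) :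
  (forall e, 0 < e -> \forall t \near F, sqnorm (f t - a) <= e) -> f @ F --> a.
Proof.
move=> fa; apply/cvg_ballP => e e0.
have e2 : 0 < (e / 2) ^+ 2 by rewrite exprn_gt0 // divr_gt0.
near=> t; split=> // i k; rewrite ord1 /ball /= /ball_.
rewrite (@le_lt_trans _ _ (e / 2)) //; last by lra.
rewrite -(@ler_pXn2r _ 2) ?nnegrE // ?divr_ge0 ?(ltW e0) //.
rewrite real_normK ?num_real //.
have -> : (a 0 k - f t 0 k) ^+ 2 = ((f t - a) 0 k) ^+ 2 by rewrite !mxE; ring.
apply: (le_trans (sqr_coord_le _ _)).
by near: t; apply: fa.
Unshelve. all: by end_near. Qed.

Lemma exists_minimizer (f : 'rV[R]_d -> R) (C : set 'rV[R]_d) c q r :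
  continuous f -> closed C -> C c ->
  (forall v, f v <= f c -> sqnorm (v - q) <= r) ->
  exists2 p, C p & forall v, C v -> f p <= f v.
Proof.
move=> cf clC Cc fr.
(* Since [r <= (1 + r) ^+ 2], the box of half-side [s] around [q] contains the sublevel set of
   [f c], with no square root. The extreme value theorem then applies on a compact set. *)
pose s := 1 + r.
have r0 : 0 <= r by apply: le_trans (fr c (lexx _)); exact: sqnorm_ge0.
pose B := [set v : 'rV[R]_d | forall k, `[q 0 k - s, q 0 k + s]%classic (v 0 k)].
have cB : compact B.
  apply: (@rV_compact _ _ (fun k => `[q 0 k - s, q 0 k + s]%classic)) => k.
  exact: segment_compact.
pose K := C `&` [set v | f v <= f c].
have KB : K `<=` B.
  move=> v [_ /fr vr] k /=; rewrite in_itv /=.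
  have := sqr_coord_le (v - q) k; rewrite !mxE => vk.
  suff : `|v 0 k - q 0 k| <= s by rewrite ler_distl => /andP[]; rewrite /s; lra.
  rewrite -(@ler_pXn2r _ 2) ?nnegrE //; last by rewrite /s; lra.
  by rewrite real_normK ?num_real // (le_trans vk) // (le_trans vr) // /s; nra.
have cK : compact K.
  apply: subclosed_compact KB => //; apply: closedI => //.
  apply: (@preimage_closed _ _ f [set x | x <= f c]) => [x _|]; first exact: cf.
  exact: closed_le.
have [|p /set_mem[Cp fpc] pmin] := EVT_min_rV _ cK (continuous_subspaceT cf).
  by exists c; split => /=.
exists p => // v Cv; have [vc|/ltW vc] := leP (f v) (f c).
  by apply: pmin; apply/mem_set.
exact: le_trans fpc vc.
Qed.

End EuclideanTopology.

(** * Projections onto intersections of half-spaces *)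

Section Projection.
Context {R : realType} {d : nat}.
Implicit Types (u v w p q z : 'rV[R]_d) (C : set 'rV[R]_d).

Definition halfspaces (J : Type) (a : J -> 'rV[R]_d) : set 'rV[R]_d :=
  [set w | forall j, 1 <= dotp (a j) w].

(** The variational inequality that characterizes the nearest point of a convex set; it is linear in
    [z], so instances can simply be added. *)
Definition is_proj C q p := C p /\ forall z, C z -> 0 <= dotp (p - q) (z - p).

Lemma closed_halfspaces (J : Type) (a : J -> 'rV[R]_d) : closed (halfspaces a).
Proof.
have -> : halfspaces a = \bigcap_(j in setT) [set w | 1 <= dotp (a j) w].
  by apply/seteqP; split=> w /= aw j => [_|]; exact: aw.
apply: closed_bigI => j _.
apply: (@preimage_closed _ _ (dotp (a j)) [set t | 1 <= t]) => [w _|].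
  exact: continuous_dotp.
exact: closed_ge.
Qed.

Lemma minimizer_is_proj C q p :
  (forall z t, C z -> 0 <= t <= 1 -> C (p + t *: (z - p))) ->
  C p -> (forall z, C z -> sqnorm (p - q) <= sqnorm (z - q)) -> is_proj C q p.
Proof.
move=> convC Cp pmin; split=> // z Cz; rewrite leNgt; apply/negP => neg.
pose c := - dotp (p - q) (z - p); pose s := sqnorm (z - p).
have c0 : 0 < c by rewrite oppr_gt0.
have s0 : 0 <= s by exact: sqnorm_ge0.
(* Moving from [p] towards [z] by [t] changes the squared distance to [q] by
   [t ^+ 2 * s - 2 * t * c]. This [t] satisfies [t * s = c - t * c], which makes the change
   negative, also when [s = 0]. *)
pose t := c / (c + s).
have t0 : 0 < t by rewrite divr_gt0 //; lra.
have t1 : t <= 1 by rewrite ler_pdivrMr; lra.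
have t01 : 0 <= t <= 1 by rewrite (ltW t0).
have := pmin _ (convC z t Cz t01).
have -> : p + t *: (z - p) - q = (p - q) + t *: (z - p) by rewrite addrAC.
rewrite (sqnormD (p - q)) sqnormZ dotpZr -/s.
have -> : dotp (p - q) (z - p) = - c by rewrite opprK.
have -> : t ^+ 2 * s = t * (c - t * c).
  by rewrite /t; field; rewrite gt_eqF //; lra.
have : 0 < t * c by exact: mulr_gt0.
have : 0 < t * (t * c) by do 2 apply: mulr_gt0 => //.
nra.
Qed.

Lemma is_proj_halfspaces_min (J : Type) (a : J -> 'rV[R]_d) q p :
  halfspaces a p ->
  (forall z, halfspaces a z -> sqnorm (p - q) <= sqnorm (z - q)) ->
  is_proj (halfspaces a) q p.
Proof.
move=> ap; apply: minimizer_is_proj => // z t az /andP[t0 t1] j.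
have := az j; have := ap j; rewrite !dotpE; nra.
Qed.

Lemma exists_proj (J : Type) (a : J -> 'rV[R]_d) q :
  halfspaces a !=set0 -> exists p, is_proj (halfspaces a) q p.
Proof.
move=> [c ac].
have [p ap pmin] := exists_minimizer (continuous_sqnormB (q := q))
  (closed_halfspaces (a := a)) ac (fun v => id).
by exists p; exact: is_proj_halfspaces_min.
Qed.

(** Testing each variational inequality at the other projection and adding gives [sqnorm (p - p') <=
    dotp (p - p') (q - q')]. *)
Lemma is_proj_nonexpansive C q q' p p' :
  is_proj C q p -> is_proj C q' p' -> sqnorm (p - p') <= sqnorm (q - q').
Proof.
move=> [Cp qp] [Cp' qp'].
have := qp _ Cp'; have := qp' _ Cp.
have := sqnorm_ge0 ((q - q') - (p - p')); rewrite sqnormB.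
have -> : p - q = (p' - q') + (p - p') - (q - q').
  by apply/rowP => k; rewrite !mxE; ring.
by rewrite -(opprB p p') /sqnorm !dotpE; lra.
Qed.

(* A point [w] with all margins at least [1 - eta] becomes feasible once divided by
   [1 - eta]. *)
Lemma is_proj_scaled (J : Type) (a : J -> 'rV[R]_d) q p w eta :
  is_proj (halfspaces a) q p -> eta < 1 ->
  (forall j, 1 - eta <= dotp (a j) w) ->
  - (eta * dotp (p - q) p) <= dotp (p - q) (w - p).
Proof.
move=> [ap qp] e1 aw.
have e0 : 0 < 1 - eta by lra.
have /qp : halfspaces a ((1 - eta)^-1 *: w).
  by move=> j; rewrite dotpZr mulrC ler_pdivlMr // mul1r.
rewrite !(dotpDr (p - q)) dotpNr dotpZr subr_ge0 mulrC ler_pdivlMr //.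
lra.
Qed.

End Projection.

(** * One local step compared with a projection *)

Section LocalStep.
Context {R : realType} {M N d : nat}.
Variables (x : 'I_M -> 'I_N -> 'rV[R]_d) (y : 'I_M -> 'I_N -> R).
Implicit Types (i : 'I_M) (q p v w : 'rV[R]_d) (lam : R).

Lemma CsetE i : Cset x y i = halfspaces (fun j => y i j *: x i j).
Proof. by apply/seteqP; split=> w xw j; have := xw j; rewrite dotpZl. Qed.

Lemma CbarE :
  Cbar x y = halfspaces (fun ij : 'I_M * 'I_N => y ij.1 ij.2 *: x ij.1 ij.2).
Proof.
apply/seteqP; split=> w xw => [[i j]|i j]; first by rewrite dotpZl; exact: xw.
by have := xw (i, j); rewrite dotpZl.
Qed.

Lemma local_loss_ge0 i w : 0 <= local_loss x y i w.
Proof. by apply: sumr_ge0 => j _; exact: expR_ge0. Qed.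

Lemma continuous_local_obj lam i q : continuous (local_obj x y lam i q).
Proof.
move=> w; apply: (@cvgD _ _ _ (nbhs w)).
  apply: (@cvg_big _ _ _ _ _ _ _ (nbhs w)) => [|j _]; first exact: add_continuous.
  apply: (cvg_comp (fun v => - (y i j * dotp (x i j) v))).
    apply: (@cvgN _ _ _ (nbhs w)); apply: (@cvgM _ _ (nbhs w)).
      exact: cvg_cst.
    exact: continuous_dotp.
  exact: continuous_expR.
apply: (@cvgM _ _ (nbhs w)); first exact: cvg_cst.
exact: continuous_sqnormB.
Qed.

Lemma local_step_min lam i q v : 0 < lam ->
  local_obj x y lam i q (local_step x y lam i q) <= local_obj x y lam i q v.
Proof.
move=> lam0; rewrite /local_step /argmin; case: xgetP => [w _ /(_ v)//|nomin].
(* The default value of [xget] is excluded: the loss is nonnegative, so the quadratic term alone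
   bounds the sublevel set of the objective at [0]. *)
have [|p _ pmin] := exists_minimizer (C := setT) (c := 0) (q := q)
  (r := local_obj x y lam i q 0 / (lam / 2))
  (@continuous_local_obj lam i q) closedT I.
  move=> w; rewrite ler_pdivlMr ?divr_gt0 // mulrC; apply: le_trans.
  by rewrite lerDr local_loss_ge0.
by case: (nomin p) => w; exact: pmin.
Qed.

(* In units of [lam], a margin below [1 - eta] costs at least [expR (L * eta)], whereas
   the competitor [L *: p] costs only [N] plus a multiple of [L ^+ 2]. *)
Lemma local_step_near_proj lam i q p eta (L := - ln lam) :
  is_proj (Cset x y i) q p -> 0 < lam -> 1 <= L -> 0 < eta < 1 ->
  6 * (sqnorm (p - q) / 2 + N%:R) < L * eta ^+ 3 ->
  sqnorm (L^-1 *: local_step x y lam i (L *: q) - p) <=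
    2 * (N%:R / L + eta * dotp (p - q) p).
Proof.
rewrite CsetE => projp lam0 L1 /andP[eta0 eta1] Lbig.
set w := local_step _ _ _ _ _; set u := L^-1 *: w; set D := sqnorm (p - q).
have D0 : 0 <= D by exact: sqnorm_ge0.
have L0 : 0 < L by lra.
have wE : w = L *: u by rewrite /u scalerA divff ?gt_eqF // scale1r.
have lamE : lam = expR (- L) by rewrite opprK lnK.
have := local_step_min i (L *: q) (L *: p) lam0.
rewrite -/w wE /local_obj -!scalerBr !sqnormZ -/D => umin.
(* All margins of [p] are at least 1, so each term at [L *: p] is at most [expR (- L) = lam]. *)
have lossp : local_loss x y i (L *: p) <= lam * N%:R.
  rewrite -[N in N%:R]card_ord mulr_natr -sumr_const; apply: ler_sum => j _.
  rewrite lamE ler_expR lerN2 dotpZr mulrCA ler_peMr ?(ltW L0) //.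
  by have := projp.1 j; rewrite dotpZl.
have sqnorm_uq : sqnorm (u - q) <= 2 * N%:R / L ^+ 2 + D.
  have : lam / 2 * (L ^+ 2 * sqnorm (u - q)) <= lam / 2 * (2 * N%:R + L ^+ 2 * D).
    by have := local_loss_ge0 i (L *: u); lra.
  rewrite ler_pM2l ?divr_gt0 // -ler_pdivlMl ?exprn_gt0 //.
  by rewrite mulrDr mulKf ?expf_neq0 ?gt_eqF // mulrC.
have margin j : 1 - eta <= dotp (y i j *: x i j) u.
  rewrite leNgt; apply/negP => viol.
  set s := L * (1 - dotp (y i j *: x i j) u).
  have sL : L * eta < s by rewrite ltr_pM2l //; lra.
  have : lam * expR s <= lam * (N%:R + L ^+ 2 * (D / 2)).
    have -> : lam * expR s = expR (- (y i j * dotp (x i j) (L *: u))).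
      rewrite lamE -expRD; congr expR.
      by rewrite /s !dotpE; ring.
    have : expR (- (y i j * dotp (x i j) (L *: u))) <= local_loss x y i (L *: u).
      rewrite /local_loss (bigD1 j) //= lerDl.
      by apply: sumr_ge0 => k _; exact: expR_ge0.
    have : 0 <= lam / 2 * (L ^+ 2 * sqnorm (u - q)).
      by rewrite !mulr_ge0 ?sqr_ge0 ?sqnorm_ge0 // ltW.
    lra.
  rewrite ler_pM2l //; apply/negP; rewrite -ltNge.
  have s0 : 0 <= s by apply: ltW; apply: le_lt_trans sL; rewrite mulr_ge0 // ltW.
  (* The cubic Taylor term [s ^+ 3 / 6] with [s > L * eta] outgrows the budget of order [L ^+ 2];
     this is the origin of the factor 6 and of [eta ^+ 3] in the hypothesis. *)
  have := expR_ge1Dxn 2 s0; apply: lt_le_trans.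
  have : (L * eta) ^+ 3 < s ^+ 3 by rewrite ltrXn2r // ?mulr_ge0 // ltW.
  have : L ^+ 2 * (6 * (D / 2 + N%:R)) < L ^+ 2 * (L * eta ^+ 3).
    by rewrite ltr_pM2l // exprn_gt0.
  have : N%:R <= L ^+ 2 * N%:R :> R by rewrite ler_peMl // expr_ge1 // ltW.
  have -> : (3`!)%:R = 6 :> R by [].
  rewrite exprMn (_ : L ^+ 2 * (L * eta ^+ 3) = L ^+ 3 * eta ^+ 3); last by ring.
  lra.
(* Expanding [sqnorm (u - q)] around [p] leaves the cross term [2 * dotp (p - q) (u - p)], which
   near-feasibility bounds from below; the rest bounds [sqnorm (u - p)]. *)
have := is_proj_scaled projp eta1 margin.
have uqE : u - q = (u - p) + (p - q) by rewrite subrKA.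
move: sqnorm_uq; rewrite {1}uqE sqnormD -/D (dotpC (u - p)).
have : N%:R / L ^+ 2 <= N%:R / L.
  rewrite ler_wpM2l // lef_pV2 ?posrE ?exprn_gt0 // expr2 ler_peMl // ltW //.
lra.
Qed.

End LocalStep.

(** * Halpern's iteration for a nonexpansive map *)

Section Halpern.
Context {R : realType} {d : nat}.

Lemma alphaE k : alpha R k = k%:R / k.+1%:R.
Proof. by rewrite /alpha; field; rewrite nat1r pnatr_eq0. Qed.

Lemma alpha_ge0 k : 0 <= alpha R k.
Proof. by rewrite alphaE divr_ge0. Qed.

Lemma invS_near (c e : R) : 0 < e -> \forall k \near \oo, c / k.+1%:R <= e.
Proof.
move=> e0; near=> k; rewrite ler_pdivrMr // mulrC -ler_pdivrMr //.
apply: (@le_trans _ _ k%:R); last by rewrite ler_nat.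
by near: k; exact: nbhs_infty_ger.
Unshelve. all: by end_near. Qed.

(** Telescoping [k.+1%:R * a k] from an index past which [eps] is at most [e / 2] leaves a fixed
    constant plus at most [k%:R * (e / 2)]; division by [k.+1%:R] makes the constant negligible. *)
Lemma weighted_descent (a eps : nat -> R) :
  (forall k, 0 <= a k) ->
  (forall k, k.+2%:R * a k.+1 <= k.+1%:R * a k + eps k) ->
  (forall e, 0 < e -> \forall k \near \oo, eps k <= e) ->
  forall e, 0 < e -> \forall k \near \oo, a k <= e.
Proof.
move=> a0 rec epslim e e0.
have [K _ epsK] := epslim (e / 2) (divr_gt0 e0 (ltr0Sn _ _)).
set c := K.+1%:R * a K.
have bound n : (K + n).+1%:R * a (K + n)%N <= c + n%:R * (e / 2).
  elim: n => [|n IH]; first by rewrite addn0 mul0r addr0.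
  rewrite addnS (le_trans (rec _)) // -[n.+1]addn1 natrD mulrDl mul1r.
  have := epsK (K + n)%N (leq_addr _ _); lra.
near=> k.
have Kk : (K <= k)%N by near: k; exact: nbhs_infty_ge.
have ck : c / (e / 2) <= k%:R by near: k; exact: nbhs_infty_ger.
move: ck; rewrite ler_pdivrMr ?divr_gt0 // => ck.
have := bound (k - K)%N; rewrite subnKC // => bk.
have kK : (k - K)%:R <= k%:R :> R by rewrite ler_nat leq_subr.
have k1 : 0 < k.+1%:R :> R by rewrite ltr0Sn.
rewrite -(ler_pM2l k1) (le_trans bk) // -[in leRHS](addn1 k) natrD; nra.
Unshelve. all: by end_near. Qed.

Variables (T : 'rV[R]_d -> 'rV[R]_d) (p : 'rV[R]_d) (v : nat -> 'rV[R]_d).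
Hypothesis T_nonexp : forall u w, enorm (T u - T w) <= enorm (u - w).
Hypothesis T_fix : T p = p.
Hypothesis v0 : v 0%N = 0.
Hypothesis vS : forall k, v k.+1 = alpha R k *: T (v k).

Lemma halpern_subE k :
  v k.+1 - p = alpha R k *: (T (v k) - T p) - k.+1%:R^-1 *: p.
Proof.
by rewrite vS T_fix /alpha; apply/rowP => j; rewrite !mxE; ring.
Qed.

(** Each iterate is a convex combination of [T (v k)] and the anchor [0], both within [enorm p] of
    [p]. *)
Lemma halpern_bounded k : enorm (v k - p) <= enorm p.
Proof.
elim: k => [|k IH]; first by rewrite v0 sub0r enormN.
rewrite halpern_subE (le_trans (enormD _ _)) // enormN !enormZ ?alpha_ge0 //.
have := le_trans (T_nonexp (v k) p) IH => /(ler_wpM2l (alpha_ge0 k)).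
have -> : k.+1%:R^-1 = 1 - alpha R k by rewrite /alpha; ring.
by lra.
Qed.

Lemma halpern_image_bounded k : enorm (T (v k)) <= 2 * enorm p.
Proof.
rewrite -(subrK (T p) (T (v k))) (le_trans (enormD _ _)) // {2}T_fix.
by have := le_trans (T_nonexp (v k) p) (halpern_bounded k); lra.
Qed.

(** Asymptotic regularity: consecutive differences vanish by [weighted_descent], and [v k.+1]
    differs from [T (v k)] only by [k.+1%:R^-1 *: T (v k)]. *)
Lemma halpern_gap e : 0 < e -> \forall k \near \oo, enorm (v k - T (v k)) <= e.
Proof.
move=> e0.
have e2 : 0 < e / 2 by rewrite divr_gt0.
have step : \forall k \near \oo, enorm (v k.+1 - v k) <= e / 2.
  apply: (@weighted_descent _ (fun k => (2 * enorm p) / k.+1%:R)) => [k|k||//].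
  - exact: enorm_ge0.
  (* The last coefficient is [alpha k.+1 - alpha k]. *)
  - have -> : v k.+2 - v k.+1 = alpha R k.+1 *: (T (v k.+1) - T (v k))
        + (k.+1%:R * k.+2%:R)^-1 *: T (v k).
      rewrite !vS !alphaE; apply/rowP => j; rewrite !mxE.
      by field; rewrite nat1r -natrD !pnatr_eq0.
    rewrite -ler_pdivlMl // (le_trans (enormD _ _)) //.
    rewrite !enormZ ?alpha_ge0 ?invr_ge0 ?mulr_ge0 //.
    have := T_nonexp (v k.+1) (v k) => /(ler_wpM2l (alpha_ge0 k.+1)).
    have kk0 : 0 <= (k.+1%:R * k.+2%:R)^-1 :> R by rewrite invr_ge0 mulr_ge0.
    have := ler_wpM2l kk0 (halpern_image_bounded k).
    have -> : k.+2%:R^-1 * (k.+1%:R * enorm (v k.+1 - v k) + 2 * enorm p / k.+1%:R)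
        = alpha R k.+1 * enorm (v k.+1 - v k) + (k.+1%:R * k.+2%:R)^-1 * (2 * enorm p).
      by rewrite alphaE; field; rewrite nat1r -natrD !pnatr_eq0.
    by move=> Tv_le TvB_le; exact: lerD.
  - by move=> e' e'0; exact: invS_near.
near=> k.
have -> : v k - T (v k) = - ((v k.+1 - v k) + k.+1%:R^-1 *: T (v k)).
  by rewrite vS /alpha; apply/rowP => j; rewrite !mxE; ring.
rewrite enormN (le_trans (enormD _ _)) // enormZ //.
have k1 : 0 <= k.+1%:R^-1 :> R by rewrite invr_ge0.
have := ler_wpM2l k1 (halpern_image_bounded k).
have : enorm (v k.+1 - v k) <= e / 2 by near: k.
have : 2 * enorm p / k.+1%:R <= e / 2 by near: k; exact: invS_near.
set c := k.+1%:R^-1; lra.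
Unshelve. all: by end_near. Qed.

(** The squared distance to [p] obeys a weighted recursion whose error is
    [- 2 * dotp p (v k.+2 - p)]; the hypothesis makes this error eventually small. *)
Lemma halpern_cvg :
  (forall e, 0 < e -> \forall k \near \oo, - e <= dotp p (v k - p)) ->
  v @ \oo --> p.
Proof.
(* The index is shifted by one because [alpha k.+1 = k.+1 / k.+2] is the ratio of weights in
   [weighted_descent]. *)
move=> acute; apply: cvg_sqnormP => e e0; apply: near_inftyS; move: e e0.
apply: (@weighted_descent _ (fun k => - (2 * dotp p (v k.+2 - p)))) => [k|k|].
- exact: sqnorm_ge0.
- set z := v k.+2 - p; set b := k.+2%:R^-1 *: p.
  set c := alpha R k.+1 *: (T (v k.+1) - T p).
  have : sqnorm c <= alpha R k.+1 * sqnorm (v k.+1 - p).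
    rewrite sqnormZ expr2 -mulrA ler_wpM2l ?alpha_ge0 //.
    have := T_nonexp (v k.+1) p; rewrite enorm_le => /(ler_wpM2l (alpha_ge0 k.+1)).
    move=> /le_trans; apply; rewrite ler_piMl ?sqnorm_ge0 // /alpha.
    by rewrite gerBl invr_ge0.
  have -> : c = z + b by rewrite /z halpern_subE subrK.
  rewrite sqnormD (dotpC z) dotpZl; have := sqnorm_ge0 b.
  rewrite -ler_pdivlMl //.
  set D := sqnorm (v k.+1 - p).
  have -> : k.+2%:R^-1 * (k.+1%:R * D + - (2 * dotp p z))
      = alpha R k.+1 * D - 2 * (k.+2%:R^-1 * dotp p z).
    by rewrite alphaE; field; rewrite -natrD pnatr_eq0.
  set c' := k.+2%:R^-1; lra.
- move=> e' e'0; have [K _ HK] := acute (e' / 2) (divr_gt0 e'0 (ltr0Sn _ _)).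
  exists K => // k /= Kk.
  by have := HK k.+2 (leqW (leqW Kk)); lra.
Qed.

End Halpern.

(** * Halpern's iteration for an average of projections *)

Section AveragedProjections.
Context {R : realType} {d M : nat} {J : finType}.
Variables (a : 'I_M -> J -> 'rV[R]_d) (P : 'I_M -> 'rV[R]_d -> 'rV[R]_d).
Hypothesis M_gt0 : (0 < M)%N.
Hypothesis projP : forall i q, is_proj (halfspaces (a i)) q (P i q).
Implicit Types (q p v : 'rV[R]_d).

Definition avg q : 'rV[R]_d := M%:R^-1 *: \sum_(i < M) P i q.

Fixpoint halpern k : 'rV[R]_d :=
  if k is k'.+1 then alpha R k' *: avg (halpern k') else 0.

Lemma scale_avg q : M%:R *: avg q = \sum_(i < M) P i q.
Proof. by rewrite /avg scalerA divff ?scale1r // pnatr_eq0 -lt0n. Qed.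

Lemma avg_nonexpansive q q' : enorm (avg q - avg q') <= enorm (q - q').
Proof.
have MR : 0 < M%:R :> R by rewrite ltr0n.
rewrite -(ler_pM2l MR) -enormZ ?(ltW MR) // scalerBr !scale_avg -sumrB.
rewrite (le_trans (enorm_sum _ _)) // -[M in leRHS]card_ord mulr_natl -sumr_const.
by apply: ler_sum => i _; rewrite enorm_le; exact: is_proj_nonexpansive.
Qed.

Lemma proj_fix i p : halfspaces (a i) p -> P i p = p.
Proof.
move=> ap; apply/eqP; rewrite -subr_eq0; apply/eqP/sqnorm_eq0.
have := (projP i p).2 p ap; rewrite -(opprB (P i p)) dotpNr oppr_ge0 => le0.
by apply/eqP; rewrite eq_le sqnorm_ge0 andbT.
Qed.

Lemma avg_fix p : (forall i, halfspaces (a i) p) -> avg p = p.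
Proof.
move=> ap; rewrite /avg (eq_bigr (fun=> p)) => [|i _]; last exact: proj_fix.
rewrite sumr_const card_ord -(scaler_nat M p) scalerA mulVf ?scale1r //.
by rewrite pnatr_eq0 -lt0n.
Qed.

(** For a common point [p], every [sqnorm (q - P k q)] is at most [dotp (q - P k q) (q - p)]. These
    terms are nonnegative, so one is at most their sum, which is [M] times
    [dotp (q - avg q) (q - p)]. *)
Lemma sqnorm_proj_le i q p : (forall i, halfspaces (a i) p) ->
  sqnorm (q - P i q) <= M%:R * (enorm (q - avg q) * enorm (q - p)).
Proof.
move=> ap; have MR : 0 <= M%:R :> R by rewrite ler0n.
apply: le_trans (ler_wpM2l MR (dotp_enorm_le _ _)).
rewrite -dotpZl scalerBr scale_avg scaler_nat -[M in _ *+ M]card_ord -sumr_const.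
rewrite -sumrB dotp_suml (bigD1 i) //=.
have term k : sqnorm (q - P k q) <= dotp (q - P k q) (q - p).
  have -> : q - p = (q - P k q) - (p - P k q) by rewrite opprB subrKA.
  rewrite dotpDr dotpNr lerDl -dotpNl opprB.
  exact: (projP k q).2.
rewrite (le_trans (term i)) // lerDl; apply: sumr_ge0 => k _.
exact: le_trans (sqnorm_ge0 _) (term k).
Qed.

Lemma halpern_near_feasible p eta : (forall i, halfspaces (a i) p) -> 0 < eta ->
  \forall k \near \oo, forall ij : 'I_M * J, 1 - eta <= dotp (a ij.1 ij.2) (halpern k).
Proof.
move=> ap eta0; apply: filter_forall => -[i j] /=.
have avg_p := avg_fix ap.
set c := sqnorm (a i j) * (M%:R * enorm p).
have c0 : 0 <= c by rewrite !mulr_ge0 ?sqnorm_ge0 ?enorm_ge0 ?ler0n.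
(* A gap [g] below this threshold gives [g * c <= eta ^+ 2]; the added 1 covers [c = 0]. *)
have gap0 : 0 < eta ^+ 2 / (1 + c) by rewrite divr_gt0 ?exprn_gt0 //; lra.
near=> k.
have : enorm (halpern k - avg (halpern k)) <= eta ^+ 2 / (1 + c).
  by near: k; exact: (@halpern_gap _ _ avg p halpern avg_nonexpansive avg_p).
set v := halpern k; rewrite ler_pdivlMr; last lra.
have vp : enorm (v - p) <= enorm p.
  exact: (@halpern_bounded _ _ avg p halpern avg_nonexpansive avg_p).
set g := enorm (v - avg v) => gap.
have g0 : 0 <= g by exact: enorm_ge0.
have : dotp (a i j) (P i v - v) ^+ 2 <= eta ^+ 2.
  rewrite (le_trans (dotp_sqr_le _ _)) // -opprB sqnormN.
  apply: (@le_trans _ _ (g * c)); last by rewrite mulrDr mulr1 in gap; lra.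
  rewrite /c mulrCA ler_wpM2l ?sqnorm_ge0 // (le_trans (sqnorm_proj_le _ _ ap)) //.
  by rewrite -/g mulrCA ler_wpM2l // ler_wpM2l ?ler0n.
move=> sqr_le; have : dotp (a i j) (P i v - v) <= eta by nra.
by have := (projP i v).1 j; rewrite dotpDr dotpNr; lra.
Unshelve. all: by end_near. Qed.

Lemma halpern_cvg_proj0 p :
  is_proj (halfspaces (fun ij : 'I_M * J => a ij.1 ij.2)) 0 p ->
  halpern @ \oo --> p.
Proof.
move=> projp; have ap i : halfspaces (a i) p by move=> j; exact: (projp.1 (i, j)).
apply: (@halpern_cvg _ _ avg p halpern avg_nonexpansive (avg_fix ap)) => // e e0.
set s := sqnorm p; have s0 : 0 <= s by exact: sqnorm_ge0.
(* This choice gives both [eta < 1] and [eta * s <= e]. *)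
set eta := e / (1 + s + e).
have den0 : 0 < 1 + s + e by lra.
have eta0 : 0 < eta by rewrite divr_gt0.
have eta1 : eta < 1 by rewrite ltr_pdivrMr //; lra.
have etas : eta * s <= e by rewrite mulrAC ler_pdivrMr //; nra.
near=> k; apply: (@le_trans _ _ (- (eta * dotp p p))); first by rewrite lerN2.
have := is_proj_scaled (w := halpern k) projp eta1; rewrite subr0; apply.
by near: k; exact: halpern_near_feasible eta0.
Unshelve. all: by end_near. Qed.

End AveragedProjections.

(** * The limit of the rescaled iterates as [lam] tends to [0+] *)

Section ScaledIterates.
Context {R : realType} {M N d : nat}.
Variables (x : 'I_M -> 'I_N -> 'rV[R]_d) (y : 'I_M -> 'I_N -> R).
Variable P : 'I_M -> 'rV[R]_d -> 'rV[R]_d.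
Hypothesis projP : forall i q, is_proj (Cset x y i) q (P i q).

Lemma near_ge_Nln (A : R) : \forall lam \near 0^'+, A <= - ln lam.
Proof.
near=> lam; have lam0 : 0 < lam by near: lam; exact: nbhs_right_gt.
rewrite lerNr -(expRK (- A)) ler_ln ?posrE ?expR_gt0 //.
by near: lam; apply: nbhs_right_ltW; exact: expR_gt0.
Unshelve. all: by end_near. Qed.

Lemma cvg_scaled_local_step (q : R -> 'rV[R]_d) q0 i :
  (- ln lam)^-1 *: q lam @[lam --> 0^'+] --> q0 ->
  (- ln lam)^-1 *: local_step x y lam i (q lam) @[lam --> 0^'+] --> P i q0.
Proof.
move=> qcvg; apply: cvg_sqnormP => e e0.
(* The rescaled centre [r] moves with [lam], so [D] bounds [sqnorm (P i r - r)] and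
   [dotp (P i r - r) (P i r)] uniformly for [r] within distance 1 of [q0]. The terms in [N%:R / L],
   in [eta * D] and in the motion of [r] then contribute [e / 3] each. *)
pose D := 2 * (2 + 2 * sqnorm (P i q0)) + 2 * (2 + 2 * sqnorm q0).
have D0 : 0 <= D.
  by rewrite /D; have := sqnorm_ge0 (P i q0); have := sqnorm_ge0 q0; lra.
pose eta := e / (12 * D + 1 + e).
have den0 : 0 < 12 * D + 1 + e by lra.
have eta0 : 0 < eta by rewrite divr_gt0.
have eta1 : eta < 1 by rewrite ltr_pdivrMr //; lra.
have etaD : 12 * (eta * D) <= e.
  have -> : 12 * (eta * D) = 12 * e * D / (12 * D + 1 + e) by rewrite /eta; ring.
  by rewrite ler_pdivrMr //; nra.
have qq0 : sqnorm ((- ln lam)^-1 *: q lam - q0) @[lam --> 0^'+] --> (0 : R).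
  rewrite -[X in _ --> X](_ : sqnorm (q0 - q0) = 0); first exact: cvg_sqnormB.
  by rewrite subrr /sqnorm dotp0l.
near=> lam.
have lam0 : 0 < lam by near: lam; exact: nbhs_right_gt.
have L1 : 1 <= - ln lam by near: lam; exact: near_ge_Nln.
have LN : 12 * N%:R / e <= - ln lam by near: lam; exact: near_ge_Nln.
have Leta : (6 * (D / 2 + N%:R) + 1) / eta ^+ 3 <= - ln lam.
  by near: lam; exact: near_ge_Nln.
have qe : sqnorm ((- ln lam)^-1 *: q lam - q0) <= e / 6.
  by near: lam; apply: (cvgr_le _ qq0); rewrite divr_gt0.
have q1 : sqnorm ((- ln lam)^-1 *: q lam - q0) <= 1.
  by near: lam; apply: (cvgr_le _ qq0).
set L := - ln lam in L1 LN Leta qe q1 *.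
have L0 : 0 < L by lra.
have qE : q lam = L *: (L^-1 *: q lam) by rewrite scalerA divff ?gt_eqF // scale1r.
rewrite qE; move: qe q1; set r := L^-1 *: q lam => qe q1.
have pq := is_proj_nonexpansive (projP i r) (projP i q0).
have p_le : sqnorm (P i r) <= 2 + 2 * sqnorm (P i q0).
  rewrite -(subrK (P i q0) (P i r)).
  by have := sqnormD_le (P i r - P i q0) (P i q0); lra.
have r_le : sqnorm r <= 2 + 2 * sqnorm q0.
  by rewrite -(subrK q0 r); have := sqnormD_le (r - q0) q0; lra.
have pr_le : sqnorm (P i r - r) <= D.
  by have := sqnormD_le (P i r) (- r); rewrite sqnormN /D; lra.
have dot_le : dotp (P i r - r) (P i r) <= D.
  have := sqnorm_ge0 (P i r - r - P i r); rewrite sqnormB.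
  have := sqnorm_ge0 (P i q0); have := sqnorm_ge0 q0; rewrite /D in pr_le *; lra.
have := @local_step_near_proj _ _ _ _ x y lam i r (P i r) eta (projP i r) lam0 L1.
rewrite eta0 eta1 -/L => /(_ isT) near_proj.
set u := L^-1 *: local_step _ _ _ _ _.
have u_le : sqnorm (u - P i r) <= 2 * (N%:R / L + eta * dotp (P i r - r) (P i r)).
  apply: near_proj.
  apply: (@lt_le_trans _ _ (6 * (D / 2 + N%:R) + 1)); first lra.
  by rewrite -ler_pdivrMr ?exprn_gt0.
have NL : 12 * (N%:R / L) <= e.
  by move: LN; rewrite mulrA !ler_pdivrMr // (mulrC L).
have etadot : eta * dotp (P i r - r) (P i r) <= eta * D by rewrite ler_pM2l.
rewrite -(subrKA (P i r)).
have := sqnormD_le (u - P i r) (P i r - P i q0); lra.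
Unshelve. all: by end_near. Qed.

Lemma cvg_scaled_w0 k :
  (- ln lam)^-1 *: w0 x y lam k @[lam --> 0^'+] --> halpern P k.
Proof.
elim: k => [|k IH].
  rewrite /=; under eq_fun do rewrite scaler0.
  exact: cvg_cst.
have -> : (fun lam => (- ln lam)^-1 *: w0 x y lam k.+1) = fun lam =>
    alpha R k *: (M%:R^-1 *:
      \sum_(i < M) (- ln lam)^-1 *: local_step x y lam i (w0 x y lam k)).
  apply/funext => lam; rewrite /= /w_init scaler0 add0r -scaler_sumr !scalerA.
  by congr (_ *: _); ring.
apply: cvgZ; first exact: cvg_cst.
apply: cvgZ; first exact: cvg_cst.
apply: cvg_big => [|i _]; first exact: add_continuous.
exact: cvg_scaled_local_step.
Qed.

Hypothesis Cbar0 : Cbar x y !=set0.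

Lemma svm_sol_is_proj : is_proj (Cbar x y) 0 (svm_sol x y).
Proof.
rewrite /svm_sol; case: xgetP => [p _ [Cp pmin]|nomin].
  rewrite CbarE in Cp pmin *; apply: is_proj_halfspaces_min => // z /pmin.
  by rewrite enorm_le !subr0.
(* The default branch of [xget] is contradictory: the projection of [0] onto [Cbar] is a point of
   least norm. *)
move: Cbar0 nomin; rewrite CbarE => /(exists_proj 0)[p [Cp pmin]] /(_ p); case.
split=> // z /pmin; rewrite subr0 enorm_le.
have -> : sqnorm z = sqnorm p + 2 * dotp p (z - p) + sqnorm (z - p).
  by rewrite -sqnormD (addrC p) subrK.
by have := sqnorm_ge0 (z - p); lra.
Qed.

Lemma svm_sol_neq0 : (0 < M)%N -> (0 < N)%N -> svm_sol x y != 0.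
Proof.
move=> M0 N0; apply/eqP => sol0.
have := svm_sol_is_proj.1 (Ordinal M0) (Ordinal N0).
by rewrite sol0 dotp0r mulr0 ler10.
Qed.

End ScaledIterates.

(** * The iterated limit of the normalized iterates *)

Lemma normalized_iterates_cvg (R : realType) (M N d : nat)
    (x : 'I_M -> 'I_N -> 'rV[R]_d) (y : 'I_M -> 'I_N -> R) :
  (0 < M)%N -> (0 < N)%N -> Cbar x y !=set0 ->
  exists u : nat -> 'rV[R]_d,
    (\forall K \near \oo, normalize (w0 x y lam K) @[lam --> 0^'+] --> u K) /\
    u @ \oo --> normalize (svm_sol x y).
Proof.
move=> M0 N0 Cbar0.
pose P i q := xget 0 [set p | is_proj (Cset x y i) q p].
have projP i q : is_proj (Cset x y i) q (P i q).
  have [|p projp] := @exists_proj _ _ _ (fun j => y i j *: x i j) q.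
    by case: Cbar0 => w Cw; exists w; rewrite -CsetE.
  apply: (@xgetPex _ 0 [set p | is_proj (Cset x y i) q p]).
  by exists p; rewrite /= CsetE.
have sol0 := svm_sol_neq0 Cbar0 M0 N0.
have vcvg : halpern P @ \oo --> svm_sol x y.
  apply: (@halpern_cvg_proj0 _ _ _ _ (fun i j => y i j *: x i j) P M0).
    by move=> i q; rewrite -CsetE.
  by rewrite -CbarE; exact: svm_sol_is_proj.
exists (fun K => normalize (halpern P K)); split; last exact: cvg_normalize.
(* Normalization is continuous only away from [0], so the inner limit is taken for large [K]; the
   iterates 0 and 1 vanish, as [alpha 0 = 0]. *)
have [K0 _ vneq0] : \forall K \near \oo, halpern P K != 0.
  exact: cvgr_neq0 vcvg sol0.
exists K0 => // K /vneq0 vK0.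
apply: cvg_trans; last exact: (cvg_normalize vK0 (cvg_scaled_w0 (k := K) projP)).
apply: near_eq_cvg; near=> lam; rewrite normalizeZ // invr_gt0.
apply: (@lt_le_trans _ _ 1) => //; near: lam; exact: near_ge_Nln.
Unshelve. all: by end_near. Qed.

(** * The null set of exceptional datasets *)

Unset Implicit Arguments.
Set Strict Implicit.

Lemma lebesgue_null_set0 (R : realType) (I : finType) (i0 : I) :
  lebesgue_null (set0 : set (I -> R)).
Proof.
(* Degenerate boxes have volume zero thanks to the coordinate [i0]; an empty product would be 1. *)
move=> e e0; exists (fun _ _ => 0), (fun _ _ => 0); split=> //.
split=> [|K]; first exact: sub0set.
rewrite big1 ?(ltW e0) // => n _.
by rewrite (bigD1 i0) //= subrr mul0r.
Qed.

Theorem theorem3 (R : realType) (M N d : nat)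
  (HM : (0 < M)%N) (HN : (0 < N)%N) (Hd : (0 < d)%N)
  (y : 'I_M -> 'I_N -> R) (Hy : forall i j, y i j = 1 \/ y i j = -1) :
  lebesgue_null
    [set X : 'I_M * 'I_N * 'I_d -> R |
      let x := data_of X in
      (forall i, Cset x y i !=set0) /\ Cbar x y !=set0 /\
      ~ (exists u : nat -> 'rV[R]_d,
           (\forall K \near \oo,
              normalize (w0 x y lam K) @[lam --> 0^'+] --> u K) /\
           u @ \oo --> normalize (svm_sol x y))].
Proof.
set A := (X in lebesgue_null X).
(* The exceptional set is empty: the limit holds at every dataset with [Cbar] nonempty. *)
have -> : A = set0.
  apply/seteqP; split=> // X [_ [Cbar0]]; apply.
  exact: normalized_iterates_cvg.
exact (lebesgue_null_set0 R _ (Ordinal HM, Ordinal HN, Ordinal Hd)).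
Qed.
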